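(* For every $\epsilon_0>0$ there exists $n_0$ such that for every $n\ge n_0$ the following holds. If $\mathcal{M}=\{M_1,\ldots,M_m\}$ is a family of $m\le(1-\epsilon_0)n$ matchings on a common vertex set, each of size $n$, and every edge (unordered pair of vertices) is contained in at most $\sqrt{n}/\log^2 n$ of the matchings $M_i$, then $\mathcal{M}$ contains a full rainbow matching.
   Context: A matching is a set of pairwise vertex-disjoint edges (unordered pairs of distinct vertices). The matchings $M_i$ may share edges, so $\bigcup_i M_i$ with multiplicities forms a multigraph properly edge-coloured by the index $i$. A full rainbow matching is a set of $m$ pairwise vertex-disjoint edges $e_1,\ldots,e_m$ with $e_i\in M_i$ for each $1\le i\le m$. *)

(* Defs.v *)
From HB Require Import structures.
From mathcomp Require Import all_boot all_order all_algebra.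
From mathcomp Require Import all_reals exp.

Set Implicit Arguments.
Unset Strict Implicit.
Unset Printing Implicit Defensive.

Section Matchings.
Variable V : finType.

Definition is_edge (e : {set V}) : bool := #|e| == 2.

Definition matching (M : {set {set V}}) : bool :=
  [forall e in M, is_edge e] && trivIset M.

(* The family is indexed rather than a set of matchings, so the [M i] may share
   edges or even coincide; an edge is counted once for each index. *)
Definition edge_mult (m : nat) (M : 'I_m -> {set {set V}}) (e : {set V}) : nat :=
  #|[set i | e \in M i]|.

Definition full_rainbow_matching (m : nat) (M : 'I_m -> {set {set V}})
    (e : 'I_m -> {set V}) : Prop :=
  (forall i, e i \in M i) /\ (forall i j, i != j -> [disjoint e i & e j]).

End Matchings.

(* Main.v *)
(* A maximum rainbow matching P leaves only few colours unused.  Let U be the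
   set of unused colours.  Starting from the vertices not covered by P, one
   grows a set F of vertices that can be uncovered, in many ways and at constant
   cost, without losing edges: if v is in F, c is in U, xv is in M_c and xy is
   in P, then uncovering v and exchanging xy for xv uncovers y.  No edge with a
   colour of U lies inside F, as it could be added to P, so each M_c with c in U
   has many edges between F and its complement.  If U were large, F would grow
   by a linear amount at each step, which is impossible after constantly many
   steps.  The small multiplicity ensures that an exchange can avoid a bounded
   set of vertices and colours.

   To use all the colours, one first sets aside a small random set S of vertices
   such that every M_i has linearly many edges inside S and loses few edges when
   S is removed.  The argument above is applied outside S, and the few remaining
   colours are then matched greedily inside S. *)

Require Import Defs.
From HB Require Import structures.
From mathcomp Require Import all_boot all_order all_algebra.
From mathcomp Require Import all_reals exp.
From mathcomp Require Import sequences zify ring lra.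

Set Implicit Arguments.
Unset Strict Implicit.
Unset Printing Implicit Defensive.

Import Order.TTheory GRing.Theory Num.Theory.

(** * Double counting and incidences with matchings *)

Lemma sum_card_exchange (I T : finType) (A : {set I}) (X : {set T})
    (r : I -> T -> bool) :
  \sum_(i in A) #|[set x in X | r i x]| = \sum_(x in X) #|[set i in A | r i x]|.
Proof.
under eq_bigr => i _ do rewrite -sum1dep_card big_mkcondr.
rewrite exchange_big /=; apply: eq_bigr => x _.
by rewrite -sum1dep_card big_mkcondr.
Qed.

Lemma card_bigcup_le (I T : finType) (D : {set I}) (F : I -> {set T}) n :
  (forall i, i \in D -> #|F i| <= n) -> #|\bigcup_(i in D) F i| <= #|D| * n.
Proof.
move=> h; rewrite -sum_nat_const.
apply: (@leq_trans (\sum_(i in D) #|F i|)); last exact: leq_sum.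
apply: (big_ind2 (fun (X : {set T}) k => #|X| <= k)) => //.
  by rewrite cards0.
move=> X1 k1 X2 k2 h1 h2; apply: leq_trans (leq_card_setU _ _) _.
exact: leq_add.
Qed.

Lemma disjointsUl (T : finType) (A B C : {set T}) :
  [disjoint A :|: B & C] = [disjoint A & C] && [disjoint B & C].
Proof. by rewrite !disjoints_subset subUset. Qed.

Section MatchingFacts.
Variable V : finType.
Implicit Types (N : {set {set V}}) (e f : {set V}).

Lemma matching_card N e : matching N -> e \in N -> #|e| = 2.
Proof. by case/andP=> /forall_inP h _ /h /eqP. Qed.

Lemma matching_eq N e f x :
  matching N -> e \in N -> f \in N -> x \in e -> x \in f -> e = f.
Proof.
case/andP=> _ /trivIsetP h he hf xe xf; apply/eqP/negPn/negP => nef.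
by move/disjoint_setI0/setP/(_ x): (h _ _ he hf nef); rewrite !inE xe xf.
Qed.

Lemma matchingS N N' : N' \subset N -> matching N -> matching N'.
Proof.
move=> sN /andP[/forall_inP h t]; apply/andP; split; last exact: trivIsetS t.
by apply/forall_inP => e /(subsetP sN) /h.
Qed.

Definition within N (S : {set V}) : {set {set V}} :=
  [set e in N | e \subset S].

Lemma matching_card_cover N :
  matching N -> #|cover N| = #|N| * 2.
Proof.
case/andP=> /forall_inP h /eqP <-.
by rewrite -sum_nat_const; apply: eq_bigr => e /h /eqP.
Qed.

(** Counted from the side of [W]: a vertex lies in at most one edge of a matching. *)
Lemma sum_card_matching_le N (W : {set V}) :
  matching N -> \sum_(e in N) #|e :&: W| <= #|W|.
Proof.
move=> mN.
have -> : \sum_(e in N) #|e :&: W| = \sum_(e in N) #|[set x in W | x \in e]|.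
  by apply: eq_bigr => e _; apply: eq_card => x; rewrite !inE andbC.
rewrite sum_card_exchange -sum1_card; apply: leq_sum => x _.
apply/card_le1_eqP => e f; rewrite !inE => /andP[eN xe] /andP[fN xf].
exact: (matching_eq mN fN eN xf xe).
Qed.

End MatchingFacts.

(** * A random set of reserved vertices *)

Section Reservoir.
Local Open Scope ring_scope.

Section RandomSubset.
Variables (R : realFieldType) (V : finType) (p : R).
Hypothesis p01 : 0 <= p <= 1.

(* The probability of [S] when each vertex is kept independently with
   probability [p]. *)
Definition weight (S : {set V}) : R :=
  \prod_v (if v \in S then p else 1 - p).

Lemma weight_ge0 S : 0 <= weight S.
Proof.
case/andP: p01 => p0 p1; apply: prodr_ge0 => v _.
by case: ifP; rewrite ?subr_ge0.
Qed.

Lemma sum_weight_superset (B : {set V}) :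
  \sum_(S : {set V}) weight S * (B \subset S)%:R = p ^+ #|B|.
Proof.
(* The factor 0 at vertices of [B] outside [S] absorbs the indicator into the product, so
   distributivity evaluates the sum over [S] vertex by vertex. *)
transitivity (\sum_(S in {set V}) \prod_v
    (if v \in S then p else if v \in B then 0 else 1 - p)).
  apply: eq_bigr => S _; have [BS|/subsetPn [x xB xS]] := boolP (B \subset S).
    rewrite mulr1; apply: eq_bigr => v _; case: ifPn => // vS.
    by rewrite (contraNF (subsetP BS v)).
  by rewrite mulr0 (bigD1 x) //= (negPf xS) xB mul0r.
rewrite -bigA_distr -prodr_const [RHS]big_mkcond; apply: eq_bigr => v _.
by rewrite /=; case: ifP => _; ring.
Qed.

Lemma sum_weight : \sum_(S : {set V}) weight S = 1.
Proof.
rewrite -[RHS](expr0 p) -(cards0 V) -sum_weight_superset.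
by apply: eq_bigr => S _; rewrite sub0set mulr1.
Qed.

(* Expanding the product over the edges of [N] into a sum over subfamilies [J]
   reduces the claim to [P(cover J \subset S) = p ^ (2 #|J|)]. *)
Lemma weight_mgf (c : R) (N : {set {set V}}) : matching N ->
  \sum_(S : {set V}) weight S * (1 + c) ^+ #|within N S| =
  (1 + c * p ^+ 2) ^+ #|N|.
Proof.
move=> mN.
transitivity (\sum_(S : {set V}) weight S * \sum_(J in {set {set V}})
    \prod_e (if e \in J then (if e \in N then c * (e \subset S)%:R else 0)
             else 1)).
  apply: eq_bigr => S _; rewrite -bigA_distr -prodr_const; congr (_ * _).
  rewrite big_mkcond; apply: eq_bigr => e _; rewrite inE.
  by case: (e \in N); case: (e \subset S) => /=;
    rewrite ?mulr1 ?mulr0 ?add0r 1?addrC.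
under eq_bigr => S _ do rewrite big_distrr.
rewrite exchange_big /=.
transitivity (\sum_(J in {set {set V}})
    \prod_e (if e \in J then (if e \in N then c * p ^+ 2 else 0) else 1)).
  apply: eq_bigr => J _; have [JN|/subsetPn [e eJ eN]] := boolP (J \subset N).
    transitivity (\sum_(S : {set V})
        c ^+ #|J| * (weight S * (cover J \subset S)%:R)).
      apply: eq_bigr => S _; rewrite mulrCA; congr (_ * _).
      rewrite -big_mkcond /= -prodr_const -[(_ \subset S)%:R]mul1r.
      have -> : (cover J \subset S)%:R = \prod_(e in J) (e \subset S)%:R :> R.
        have [sJ|/bigcupsP sJ] := boolP (cover J \subset S).
          rewrite big1 // => e eJ; rewrite (subset_trans _ sJ) //.
          exact: bigcup_sup.
        apply/esym/eqP/prodf_eq0.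
        have /subsetPn [x /bigcupP [e eJ xe] xS] : ~~ (cover J \subset S).
          by apply/bigcupsP.
        exists e => //; rewrite pnatr_eq0 eqb0; apply: contra xS.
        by move/subsetP; apply.
      rewrite mul1r -big_split; apply: eq_bigr => e eJ /=.
      by rewrite (subsetP JN).
    rewrite -big_distrr /= sum_weight_superset.
    rewrite (matching_card_cover (matchingS JN mN)) mulnC exprM -exprMn.
    rewrite -big_mkcond /= -prodr_const; apply: eq_bigr => e eJ.
    by rewrite (subsetP JN).
  rewrite [RHS](bigD1 e) //= eJ (negPf eN) mul0r big1 // => S _.
  by rewrite (bigD1 e) //= eJ (negPf eN) mul0r mulr0.
rewrite -bigA_distr -prodr_const [RHS]big_mkcond; apply: eq_bigr => e _.
by rewrite /=; case: ifP => _; rewrite ?add0r // addrC.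
Qed.

(** Exponential Markov inequality: [weight_mgf] at [c = -1/2] gives the mean of
    [2 ^ -#|within N S|], and this variable is at least [2 ^ -a] on the event. *)
Lemma weight_tail (N : {set {set V}}) a : matching N ->
  \sum_(S : {set V} | (#|within N S| <= a)%N) weight S <=
  2 ^+ a * (1 - p ^+ 2 / 2) ^+ #|N|.
Proof.
move=> mN; have := weight_mgf (- (1 / 2)) mN.
have -> : 1 + - (1 / 2) * p ^+ 2 = 1 - p ^+ 2 / 2 :> R by field.
have -> : 1 + - (1 / 2) = 2^-1 :> R by field.
move=> <-; rewrite big_distrr big_mkcond; apply: ler_sum => S _ /=.
rewrite mulrCA; case: ifP => h; last first.
  by rewrite mulr_ge0 ?weight_ge0 // mulr_ge0 // exprn_ge0 // invr_ge0.
rewrite -[leLHS]mulr1 ler_wpM2l ?weight_ge0 // exprVn -(subnK h) exprD mulfK.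
  by rewrite exprn_ege1 // ler1n.
by rewrite expf_neq0 // pnatr_eq0.
Qed.

End RandomSubset.

Lemma weightC (R : realFieldType) (V : finType) (p : R) (S : {set V}) :
  weight p (~: S) = weight (1 - p) S.
Proof.
by apply: eq_bigr => v _; rewrite inE; case: (v \in S); rewrite ?subKr.
Qed.

(* Markov's inequality for [2 ^ -|within (M i) S|] and a union bound. *)
Lemma exists_split (R : realFieldType) (V : finType) (m n a b : nat)
    (M : 'I_m -> {set {set V}}) (p : R) : 0 <= p <= 1 ->
  (forall i, matching (M i)) -> (forall i, #|M i| = n) ->
  m%:R * (2 ^+ a * (1 - p ^+ 2 / 2) ^+ n +
          2 ^+ b * (1 - (1 - p) ^+ 2 / 2) ^+ n) < 1 ->
  exists S, forall i,
    (a < #|within (M i) S|)%N /\ (b < #|within (M i) (~: S)|)%N.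
Proof.
move=> p01 mM cM small.
have q01 : 0 <= 1 - p <= 1 by case/andP: p01 => *; apply/andP; split; lra.
pose good S := [forall i, (a < #|within (M i) S|)%N &&
  (b < #|within (M i) (~: S)|)%N].
have [S /forallP gS|bad] := pickP good.
  by exists S => i; apply/andP.
suff : 1 <= m%:R * (2 ^+ a * (1 - p ^+ 2 / 2) ^+ n +
          2 ^+ b * (1 - (1 - p) ^+ 2 / 2) ^+ n) by rewrite leNgt small.
rewrite -[leLHS](sum_weight V p).
have -> : m%:R * (2 ^+ a * (1 - p ^+ 2 / 2) ^+ n +
          2 ^+ b * (1 - (1 - p) ^+ 2 / 2) ^+ n) = \sum_(i < m)
    (2 ^+ a * (1 - p ^+ 2 / 2) ^+ #|M i| +
          2 ^+ b * (1 - (1 - p) ^+ 2 / 2) ^+ #|M i|).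
  under eq_bigr => i _ do rewrite cM.
  by rewrite sumr_const card_ord mulr_natl.
apply: (@le_trans _ _ (\sum_(i < m)
    (\sum_(S : {set V} | (#|within (M i) S| <= a)%N) weight p S +
     \sum_(S : {set V} | (#|within (M i) (~: S)| <= b)%N) weight p S))).
  have E i : \sum_(S : {set V} | (#|within (M i) S| <= a)%N) weight p S +
      \sum_(S : {set V} | (#|within (M i) (~: S)| <= b)%N) weight p S =
      \sum_(S : {set V})
        ((if (#|within (M i) S| <= a)%N then weight p S else 0) +
        (if (#|within (M i) (~: S)| <= b)%N then weight p S else 0)).
    by rewrite big_split -!big_mkcond.
  under [leRHS]eq_bigr => i _ do rewrite E.
  rewrite exchange_big; apply: ler_sum => S _ /=.
  have /negbT/forallPn [i hi] := bad S.
  have t0 j : 0 <= (if (#|within (M j) S| <= a)%N then weight p S else 0) +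
      (if (#|within (M j) (~: S)| <= b)%N then weight p S else 0).
    by apply: addr_ge0; case: ifP; rewrite ?weight_ge0.
  rewrite (bigD1 i) //= -[leLHS]addr0; apply: lerD; last exact: sumr_ge0.
  move: hi; rewrite negb_and -!leqNgt => /orP[] -> /=.
    by rewrite lerDl; case: ifP; rewrite ?weight_ge0.
  by rewrite lerDr; case: ifP; rewrite ?weight_ge0.
apply: ler_sum => i _; apply: lerD; first exact: weight_tail.
apply: le_trans (weight_tail q01 b (mM i)).
(* Complementation turns the event on [~: S] at density [p] into the event on [S] at density
   [1 - p]. *)
rewrite (reindex_inj (@setC_inj V)) /=; under eq_bigl => S do rewrite setCK.
by under eq_bigr => S _ do rewrite weightC.
Qed.

(** * Numerical estimates and the choice of the density *)

Lemma exp_linear (C q : nat) : (0 < q)%N ->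
  exists n0, forall n, (n0 <= n)%N -> (C * n < 2 ^ (n %/ q))%N.
Proof.
move=> q0; exists (q * (4 * C * q + 4))%N => n hn; set d := (n %/ q)%N.
have hd : (4 * C * q + 4 <= d)%N by rewrite leq_divRL // mulnC.
have hnd : (n < d.+1 * q)%N by rewrite -ltn_divLR.
(* A quadratic lower bound for [2 ^ d] already beats any linear function of [n]. *)
have h2 : (d./2.+1 ^ 2 <= 2 ^ d)%N.
  apply: (@leq_trans ((2 ^ d./2) ^ 2)).
    by rewrite leq_exp2r // ltn_expl.
  by rewrite -expnM leq_exp2l // muln2 -[leqRHS]odd_double_half leq_addl.
apply: leq_trans h2; have hd2 : (d <= d./2.*2.+1)%N.
  by rewrite -[leqLHS]odd_double_half -add1n leq_add2r leq_b1.
move: hd hnd hd2; move: (d./2) => h; rewrite -muln2 => hd hnd hd2.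
have : (2 * C * q < h.+1)%N by move: hd hd2; clear; lia.
have : (C * n <= C * (2 * h.+1 * q))%N.
  by rewrite leq_mul2l (leq_trans (ltnW hnd)) ?orbT // leq_mul2r; lia.
rewrite expnS expn1; move: (h.+1) => k; clear; nia.
Qed.

(** Induction on [(1 - y) * (1 + (s + 1) * y) <= 1 + s * y]. Negative [y] is allowed, which bounds
    powers of numbers above 1. *)
Lemma bernoulli_le (R : realFieldType) (y : R) s : y <= 1 ->
  (1 - y) ^+ s * (1 + s%:R * y) <= 1.
Proof.
move=> y1; elim: s => [|s IH]; first by rewrite expr0 mul0r addr0 mulr1.
apply: le_trans IH; rewrite exprS mulrAC mulrC.
rewrite ler_wpM2l ?exprn_ge0 ?subr_ge0 // -natr1.
have : 0 <= (s%:R + 1) * y ^+ 2 by rewrite mulr_ge0 ?sqr_ge0 ?addr_ge0.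
by rewrite expr2; lra.
Qed.

(* With [p = 1 / (6 J)], [a = n / q] and [b = n - n / J] both tail bounds of
   [exists_split] decay exponentially in [n]. *)
Lemma split_parameters (R : realFieldType) (J : nat) : (0 < J)%N ->
  exists q n0 : nat, forall n, (n0 <= n)%N -> exists (p : R) (a b : nat),
    [/\ 0 <= p <= 1, (n < q * a.+1)%N, (J * n <= J * b + n)%N &
     n%:R * (2 ^+ a * (1 - p ^+ 2 / 2) ^+ n +
             2 ^+ b * (1 - (1 - p) ^+ 2 / 2) ^+ n) < 1].
Proof.
(* Chosen so that [s * (p ^ 2 / 2) = 1]; Bernoulli then gives [r ^ s <= 1 / 2]. *)
move=> J0; pose s := (72 * J ^ 2)%N.
have s0 : (0 < s)%N by rewrite muln_gt0 expn_gt0 J0.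
have [n1 h1] := @exp_linear 4 (2 * s) ltac:(by rewrite muln_gt0).
have [n2 h2] := @exp_linear 4 (J * 3) ltac:(by rewrite muln_gt0 J0).
exists (2 * s)%N, (maxn n1 n2) => n; rewrite geq_max => /andP[/h1 hn1 /h2 hn2].
have J1 : 1 <= J%:R :> R by rewrite ler1n.
have [p pJ] : exists p : R, 6 * J%:R * p = 1.
  by exists (6 * J%:R)^-1; rewrite mulfV // mulf_neq0 // pnatr_eq0 -?lt0n.
have p0 : 0 <= p by nra.
have p1 : p <= 1 / 6 by nra.
set a := (n %/ (2 * s))%N; set d := (n %/ J)%N.
exists p, a, (n - d)%N; split.
- by apply/andP; split; lra.
- by rewrite mulnC ltn_ceil // muln_gt0.
- rewrite -[in leqLHS](subnK (leq_div n J)) mulnDr leq_add2l mulnC.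
  exact: leq_divM.
have dn : (d <= n)%N by exact: leq_div.
set r := 1 - p ^+ 2 / 2; set r' := 1 - (1 - p) ^+ 2 / 2.
have p2 : 0 <= p ^+ 2 <= 1 by rewrite sqr_ge0 expr_le1 //; lra.
have r0 : 0 <= r by rewrite /r; lra.
have r1 : r <= 1 by rewrite /r; lra.
have r'0 : 0 <= r' by rewrite /r'; nra.
have r'1 : r' <= (1 + 2 * p) / 2 by rewrite /r'; nra.
have x1 : 2 ^+ a * r ^+ n <= (2 ^+ a)^-1.
  have rs : r ^+ s * 2 <= 1.
    have y1 : p ^+ 2 / 2 <= 1 by lra.
    have := bernoulli_le s y1; rewrite -/r.
    suff -> : s%:R * (p ^+ 2 / 2) = 1 by [].
    transitivity ((6 * J%:R * p) ^+ 2); last by rewrite pJ expr1n.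
    by rewrite natrM natrX; field.
  rewrite -[leRHS]mul1r ler_pdivlMr ?exprn_gt0 // mulrAC -exprD addnn -mul2n.
  apply: (@le_trans _ _ (2 ^+ (2 * a) * r ^+ (s * (2 * a)))).
    rewrite ler_wpM2l ?exprn_ge0 // ler_wiXn2l //.
    by rewrite mulnCA mulnA mulnC leq_divM.
  rewrite [r ^+ _]exprM -exprMn exprn_ile1 //; last by rewrite mulrC.
  by rewrite mulr_ge0 // exprn_ge0.
(* With [d = n %/ J], the product is at most [(1 + 2 * p) ^ n / 2 ^ d]. Since [2 * p * J = 1 / 3],
   each block of [J] factors is at most [3 / 2], leaving [3 / 2 * (3 / 4) ^ d]; finally
   [(3 / 4) ^ 3 <= 1 / 2]. *)
have x2 : 2 ^+ (n - d) * r' ^+ n <= 3 / 2 * (2 ^+ (n %/ (J * 3)))^-1.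
  have rJ : (1 + 2 * p) ^+ J <= 3 / 2.
    have y1 : - (2 * p) <= 1 by lra.
    have := bernoulli_le J y1; rewrite opprK.
    have -> : 1 + J%:R * - (2 * p) = 2 / 3 by lra.
    by lra.
  have q1 : 1 <= 1 + 2 * p by lra.
  have q0 : 0 <= 1 + 2 * p by lra.
  apply: (@le_trans _ _ (2 ^+ (n - d) * ((1 + 2 * p) / 2) ^+ n)).
    by rewrite ler_wpM2l ?exprn_ge0 // lerXn2r // nnegrE; lra.
  have -> : 2 ^+ (n - d) * ((1 + 2 * p) / 2) ^+ n =
      (1 + 2 * p) ^+ n * (2^-1 ^+ d).
    rewrite exprMn mulrCA; congr (_ * _).
    rewrite -{2}(subnK dn) exprD mulrA -exprMn.
    by rewrite mulfV ?pnatr_eq0 // expr1n mul1r.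
  apply: (@le_trans _ _ ((3 / 2) ^+ d.+1 * 2^-1 ^+ d)).
    rewrite ler_wpM2r ?exprn_ge0 ?invr_ge0 //.
    apply: (@le_trans _ _ ((1 + 2 * p) ^+ (J * d.+1))).
      by rewrite ler_weXn2l // mulnC ltnW // ltn_ceil.
    by rewrite exprM lerXn2r // nnegrE ?exprn_ge0 //; lra.
  rewrite exprS -mulrA -exprMn ler_wpM2l //; first by lra.
  rewrite divnMA -/d -exprVn.
  have -> : 3 / 2 * 2^-1 = 3 / 4 :> R by field.
  apply: (@le_trans _ _ ((3 / 4) ^+ (3 * (d %/ 3)))).
    by rewrite ler_wiXn2l ?(mulnC 3) ?leq_divM //; lra.
  rewrite exprM; apply: lerXn2r; rewrite ?nnegrE ?invr_ge0 //.
    by apply: exprn_ge0; lra.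
  by rewrite !exprS expr0; lra.
have nn0 : 0 <= n%:R :> R by [].
have := ler_wpM2l nn0 x1; have := ler_wpM2l nn0 x2; rewrite mulrDr.
have b1 : (n%:R : R) * (2 ^+ a)^-1 < 1 / 4.
  rewrite ltr_pdivrMr ?exprn_gt0 // mulrC mulrA ltr_pdivlMr ?ltr0n // mulr1.
  by rewrite -natrX -natrM ltr_nat mulnC.
have b2 : (n%:R : R) * (2 ^+ (n %/ (J * 3)))^-1 < 1 / 4.
  rewrite ltr_pdivrMr ?exprn_gt0 // mulrC mulrA ltr_pdivlMr ?ltr0n // mulr1.
  by rewrite -natrX -natrM ltr_nat mulnC.
by lra.
Qed.

(** [J] prescribes how small a fraction of each matching may be lost outside [S]; [q] is the price,
    the inverse of the fraction kept inside. The density is rational, so [rat] serves as the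
    field. *)
Lemma exists_reservoir (J : nat) : (0 < J)%N ->
  exists q n0 : nat, forall n, (n0 <= n)%N ->
  forall (V : finType) (m : nat) (M : 'I_m -> {set {set V}}),
    (m <= n)%N -> (forall i, matching (M i)) -> (forall i, #|M i| = n) ->
    exists S : {set V}, forall i, (n <= q * #|within (M i) S|)%N /\
      (J * n <= J * #|within (M i) (~: S)| + n)%N.
Proof.
move=> /(split_parameters rat) [q [n0 h]]; exists q, n0 => n /h.
move=> [p [a [b [p01 ha hb small]]]] V m M mn mM cM.
have [|S hS] := @exists_split _ V m n a b M p p01 mM cM.
  apply: le_lt_trans small; rewrite ler_wpM2r ?ler_nat //.
  case/andP: p01 => p0 p1.
  by rewrite addr_ge0 // mulr_ge0 // exprn_ge0 //; nra.
exists S => i; have [hi1 hi2] := hS i; split.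
  by rewrite ltnW // (leq_trans ha) // leq_mul2l hi1 orbT.
by apply: leq_trans hb _; rewrite leq_add2r leq_mul2l (ltnW hi2) orbT.
Qed.

End Reservoir.

(** * Exchanges along unused colours *)

Section RainbowMatchings.
Variables (V : finType) (m : nat) (M : 'I_m -> {set {set V}}).
Hypothesis matchingM : forall i, matching (M i).

(* A partial rainbow matching is stored as a set of pairs (colour, edge). *)
Local Notation cedge := ('I_m * {set V})%type.
Implicit Types (P Q A B : {set cedge}) (a b p q : cedge) (Z W : {set V}).

Definition rainbow P : bool :=
  [forall a in P, a.2 \in M a.1] &&
  [forall a in P, forall b in P,
     (a != b) ==> (a.1 != b.1) && [disjoint a.2 & b.2]].

Lemma rainbowP P :
  reflect ((forall a, a \in P -> a.2 \in M a.1) /\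
           (forall a b, a \in P -> b \in P -> a != b ->
              a.1 != b.1 /\ [disjoint a.2 & b.2]))
          (rainbow P).
Proof.
apply: (iffP andP) => -[h1 h2]; split.
- exact/forall_inP.
- move=> a b aP bP; move/forall_inP: h2 => /(_ a aP) /forall_inP /(_ b bP).
  by move/implyP=> h /h /andP.
- exact/forall_inP.
- apply/forall_inP => a aP; apply/forall_inP => b bP; apply/implyP => nab.
  exact/andP/h2.
Qed.

Lemma rainbow0 : rainbow set0.
Proof. by apply/rainbowP; split=> [a|a b]; rewrite inE. Qed.

Lemma rainbow1 c e : e \in M c -> rainbow [set (c, e)].
Proof.
move=> he; apply/rainbowP; split=> [a /set1P -> //|a b /set1P -> /set1P ->].
by rewrite eqxx.
Qed.

Lemma rainbowS P Q : Q \subset P -> rainbow P -> rainbow Q.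
Proof.
move=> /subsetP sQ /rainbowP[h1 h2]; apply/rainbowP.
by split=> [a /sQ /h1 //|a b /sQ aP /sQ bP]; exact: h2.
Qed.

Lemma rainbowU A B : rainbow A -> rainbow B ->
  (forall a b, a \in A -> b \in B -> a.1 != b.1 /\ [disjoint a.2 & b.2]) ->
  rainbow (A :|: B).
Proof.
move=> /rainbowP[hA1 hA2] /rainbowP[hB1 hB2] hAB; apply/rainbowP; split.
  by move=> a /setUP[/hA1|/hB1].
move=> a b /setUP[aA|aB] /setUP[bA|bB] nab.
- exact: hA2.
- exact: hAB.
- by have [h1 h2] := hAB _ _ bA aB; rewrite eq_sym disjoint_sym.
- exact: hB2.
Qed.

Lemma rainbow_mem P a : rainbow P -> a \in P -> a.2 \in M a.1.
Proof. by case/rainbowP=> h _; exact: h. Qed.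

Lemma rainbow_card P a : rainbow P -> a \in P -> #|a.2| = 2.
Proof. by move=> rP /(rainbow_mem rP) /(matching_card (matchingM _)). Qed.

Lemma rainbow_colour_inj P a b :
  rainbow P -> a \in P -> b \in P -> a.1 = b.1 -> a = b.
Proof.
case/rainbowP=> _ h aP bP eab; apply/eqP/negPn/negP => nab.
by have [] := h a b aP bP nab; rewrite eab eqxx.
Qed.

Lemma rainbow_disjoint P a b :
  rainbow P -> a \in P -> b \in P -> a != b -> [disjoint a.2 & b.2].
Proof. by case/rainbowP=> _ h aP bP nab; have [] := h a b aP bP nab. Qed.

Lemma rainbow_eq P a b x : rainbow P ->
  a \in P -> b \in P -> x \in a.2 -> x \in b.2 -> a = b.
Proof.
move=> rP aP bP xa xb; apply/eqP/negPn/negP => /(rainbow_disjoint rP aP bP).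
by move/disjoint_setI0/setP/(_ x); rewrite !inE xa xb.
Qed.

Definition unused P : {set 'I_m} := ~: [set a.1 | a in P].

Lemma unusedP P c a : c \in unused P -> a \in P -> a.1 != c.
Proof.
by rewrite inE => h aP; apply: contraNneq h => <-; apply: imset_f.
Qed.

Lemma card_unused P : rainbow P -> #|unused P| + #|P| = m.
Proof.
move=> rP; have <- : #|[set a.1 | a in P]| = #|P|.
  by apply: card_in_imset => a b aP bP; exact: (rainbow_colour_inj rP).
by rewrite addnC cardsC card_ord.
Qed.

(** Equality holds because each vertex of [W] lies in exactly one edge of [P]. *)
Lemma sum_card_rainbow P W : rainbow P ->
  (forall x, x \in W -> exists2 a, a \in P & x \in a.2) ->
  \sum_(a in P) #|a.2 :&: W| = #|W|.
Proof.
move=> rP hW.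
transitivity (\sum_(a in P) #|[set x in W | x \in a.2]|).
  by apply: eq_bigr => a _; apply: eq_card => x; rewrite !inE andbC.
rewrite sum_card_exchange -sum1_card; apply: eq_bigr => x /hW [a aP xa].
apply/eqP/cards1P; exists a; apply/setP => b; rewrite !inE.
apply/andP/eqP => [[bP xb]|-> //].
exact: (rainbow_eq rP bP aP xb xa).
Qed.

Definition inside P Z : {set cedge} := [set p in P | p.2 \subset Z].

(* Replacing the edges of [P] inside [Z] by [A] gives a rainbow matching that
   leaves [v] uncovered. *)
Record releases P (A : {set cedge}) Z v : Prop := Releases {
  rel_in : v \in Z;
  rel_rainbow : rainbow A;
  rel_sub : forall a, a \in A -> a.2 \subset Z :\ v;
  rel_unused : forall a, a \in A -> a.1 \in unused P;
  rel_closed : forall p, p \in P -> p.2 \subset Z \/ [disjoint p.2 & Z];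
  rel_card : #|inside P Z| <= #|A| }.

Definition releasable P k (BV : {set V}) (BC : {set 'I_m}) v : Prop :=
  exists Z A, releases P A Z v /\
    [/\ [disjoint Z & BV], #|Z| <= k.*2.+1, #|A| <= k
      & forall a, a \in A -> a.1 \notin BC].

(* Each step of a chain of exchanges spends two vertices and one colour of the
   budget [N] of forbidden objects. *)
Definition robust P N k v : Prop :=
  forall (BV : {set V}) (BC : {set 'I_m}), v \notin BV ->
    (forall p, p \in P -> v \in p.2 -> [disjoint p.2 & BV]) ->
    #|BV| + k.*2 <= N -> #|BC| + k <= N -> releasable P k BV BC v.

Lemma robust0 P N v : rainbow P ->
  (forall p, p \in P -> v \notin p.2) -> robust P N 0 v.
Proof.
move=> rP hv BV BC vB _ _ _; exists [set v], set0; split; last first.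
  by split; rewrite ?cards1 ?cards0 ?disjoints1 // => a; rewrite inE.
split=> [||a|a|p pP|]; rewrite ?set11 ?rainbow0 ?inE //.
  by right; rewrite disjoint_sym disjoints1 hv.
rewrite cards0 leqn0 cards_eq0 -subset0; apply/subsetP => p; rewrite !inE.
case/andP=> pP sp; have := subset_leq_card sp.
by rewrite (rainbow_card rP pP) cards1.
Qed.

Lemma robustS P N k v : robust P N k v -> robust P N k.+1 v.
Proof.
move=> h BV BC vB pB hV hC.
have [|| Z [A [hr [h1 h2 h3 h4]]]] := h BV BC vB pB; [lia | lia |].
by exists Z, A; split=> //; split=> //; lia.
Qed.

(** A vertex outside [star P b] differs from [b] and shares no edge of [P] with it, which is what
    [robust] asks of a forbidden [b]. *)
Definition star P v : {set V} := v |: \bigcup_(p in P | v \in p.2) p.2.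

Lemma card_star P v : rainbow P -> #|star P v| <= 3.
Proof.
move=> rP; apply: leq_trans (leq_card_setU _ _) _; rewrite cards1 ltnS.
have [p /andP[pP vp]|h] := pickP [pred p in P | v \in p.2]; last first.
  by rewrite big_pred0 ?cards0.
rewrite -(rainbow_card rP pP); apply: subset_leq_card.
by apply/bigcupsP => q /andP[qP vq]; rewrite (rainbow_eq rP qP pP vq vp).
Qed.

Lemma mem_star P v p : p \in P -> v \in p.2 -> p.2 \subset star P v.
Proof.
by move=> pP vp; apply/subsetU/orP; right; apply: bigcup_sup; rewrite pP.
Qed.

(** * One exchange, and its limits in a maximum rainbow matching *)

Section Extension.
Variables (P : {set cedge}) (N k : nat) (F : {set V}).
Hypothesis rainbowP0 : rainbow P.
Hypothesis robustF : forall v, v \in F -> robust P N k v.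

(** Few colours are blocked: at most [N] by [BC], and for each of at most [N] vertices [b] of [BV]
    at most [3 * mu], those of the edges from [x] to [star P b]. A surviving colour [c] and edge
    [xv] allow releasing [v] away from [x], [y] and [c], after which [xv] replaces [xy]. *)
Lemma robust_step (mu : nat) p x y :
  (forall e, edge_mult M e <= mu) ->
  p \in P -> p.2 = [set x; y] -> [disjoint p.2 & F] ->
  N + N * (3 * mu) <
    #|[set c in unused P | [exists v in F, [set x; v] \in M c]]| ->
  robust P N k.+1 y.
Proof.
move=> hmu pP epx dF hmany BV BC yB pB hV hC.
have nxy : x != y.
  by have := rainbow_card rainbowP0 pP; rewrite epx cards2; case: eqVneq.
have dpB : [disjoint p.2 & BV] by apply: pB; rewrite // epx !inE eqxx orbT.
have : [exists c, exists v, [&& c \in unused P, c \notin BC,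
    v \in F, [set x; v] \in M c & v \notin \bigcup_(b in BV) star P b]].
  apply: contraTT hmany => /existsPn hno; rewrite -leqNgt.
  suff sub : [set c in unused P | [exists v in F, [set x; v] \in M c]] \subset
      BC :|: \bigcup_(b in BV) \bigcup_(v in star P b)
               [set c | [set x; v] \in M c].
    apply: leq_trans (subset_leq_card sub) _.
    apply: leq_trans (leq_card_setU _ _) _.
    have [hV' hC'] : #|BV| <= N /\ #|BC| <= N.
      by move: hV hC; clear; lia.
    apply: leq_add => //; apply: (@leq_trans (#|BV| * (3 * mu))); last first.
      by rewrite leq_mul2r hV' orbT.
    apply: card_bigcup_le => b _.
    apply: (@leq_trans (#|star P b| * mu)).
      by apply: card_bigcup_le => v _; exact: hmu.
    by rewrite leq_mul2r card_star // orbT.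
  apply/subsetP => c; rewrite inE => /andP[cU /exists_inP[v vF xv]].
  rewrite inE; case: (boolP (c \in BC)) => //= cBC.
  have /existsPn/(_ v) := hno c; rewrite cU cBC vF xv /= negbK.
  case/bigcupP => b bB vb; apply/bigcupP; exists b => //; apply/bigcupP.
  by exists v => //; rewrite inE.
case/existsP=> c /existsP[v /and5P[cU cBC vF xv vB]].
have vnp : v \notin p.2.
  by apply/negP => vp; move: (disjointFr dF vp); rewrite vF.
have vnx : v != x by apply: contraNneq vnp => ->; rewrite epx !inE eqxx.
have vny : v != y by apply: contraNneq vnp => ->; rewrite epx !inE eqxx orbT.
have [|q qP vq||| Z [A [[vZ rA sA uA cl kA] [ZB kZ kA' AC]]]] :=
    robustF vF (BV := BV :|: [set x; y]) (BC := c |: BC).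
- rewrite !inE (negPf vnx) (negPf vny) !orbF; apply: contra vB => vBV.
  by apply/bigcupP; exists v => //; rewrite !inE eqxx.
- rewrite disjoint_sym disjointsUl -epx ![[disjoint _ & q.2]]disjoint_sym.
  rewrite (rainbow_disjoint rainbowP0 qP pP) ?andbT; last first.
    by apply: contraTneq vq => ->.
  rewrite -setI_eq0; apply: contraR vB => /set0Pn [z /setIP[zq zB]].
  by apply/bigcupP; exists z => //; apply: (subsetP (mem_star qP zq)).
- apply: leq_trans (leq_add (leq_card_setU _ _) (leqnn _)) _.
  by rewrite cards2 nxy; move: hV; clear; lia.
- apply: leq_trans (leq_add (leq_card_setU _ _) (leqnn _)) _.
  by rewrite cards1; move: hC; clear; lia.
rewrite disjoint_sym disjointsUl ![[disjoint _ & Z]]disjoint_sym in ZB.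
case/andP: ZB => ZB; rewrite -epx => Zp.
have xZ : x \notin Z by rewrite (disjointFl Zp) // epx !inE eqxx.
have yZ : y \notin Z by rewrite (disjointFl Zp) // epx !inE eqxx orbT.
have cA : forall a, a \in A -> a.1 != c.
  by move=> a /AC; rewrite !inE negb_or => /andP[].
have cxvA : (c, [set x; v]) \notin A by apply/negP => /cA; rewrite eqxx.
(* The edge [xv] fits since [v] is free after the exchange in [Z]; only [y] is left uncovered by
   it. *)
exists (Z :|: p.2), ((c, [set x; v]) |: A); split; last first.
  split.
  - by rewrite disjointsUl ZB.
  - apply: leq_trans (leq_card_setU _ _) _.
    by rewrite (rainbow_card rainbowP0 pP); move: kZ; clear; lia.
  - by rewrite cardsU1 cxvA.
  - move=> a /setU1P[-> //|/AC]; by rewrite !inE negb_or => /andP[].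
split.
- by rewrite epx !inE eqxx !orbT.
- apply: rainbowU (rainbow1 xv) rA _ => a b /set1P -> bA /=.
  rewrite eq_sym cA //; split=> //; rewrite disjointsUl !disjoints1.
  apply/andP; split; apply/negP => /(subsetP (sA _ bA)).
    by rewrite !inE (negPf xZ) andbF.
  by rewrite !inE eqxx.
- move=> a /setU1P[-> /=|aA].
    apply/subsetP => z; rewrite epx !inE => /orP[] /eqP->.
      by rewrite nxy eqxx orbT.
    by rewrite vny vZ.
  apply: subset_trans (sA a aA) _; apply/subsetP => z; rewrite !inE.
  by case/andP=> _ zZ; rewrite zZ andbT; apply: contraNneq yZ => <-.
- by move=> a /setU1P[-> //|/uA].
- move=> q qP; have [->|nqp] := eqVneq q p; first by left; exact: subsetUr.
  have [h|h] := cl q qP; first by left; apply: subset_trans h (subsetUl _ _).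
  right; rewrite disjoint_sym disjointsUl disjoint_sym h.
  by rewrite (rainbow_disjoint rainbowP0) // eq_sym.
- rewrite cardsU1 cxvA.
  (* The edge [p] is the only one lost in addition: any other edge of [P] in the union misses [p],
     hence lies in [Z]. *)
  apply: (@leq_trans #|p |: inside P Z|); last first.
    by apply: leq_trans (leq_card_setU _ _) _; rewrite cards1 leq_add2l.
  apply: subset_leq_card; apply/subsetP => q; rewrite !inE => /andP[qP sq].
  case: eqVneq => //= nqp; rewrite qP /=.
  apply/subsetP => z zq; move/subsetP: sq => /(_ z zq); rewrite inE.
  case/orP=> // zp; move: nqp.
  by rewrite (rainbow_eq rainbowP0 qP pP zq zp) eqxx.
Qed.

Hypothesis maxP : forall Q, rainbow Q -> #|Q| <= #|P|.

(** Replacing the edges of [P] inside [Z] by [A] gives a rainbow matching, which cannot be larger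
    than [P]. *)
Lemma max_inside A Z :
  rainbow A -> (forall a, a \in A -> a.2 \subset Z) ->
  (forall a, a \in A -> a.1 \in unused P) ->
  (forall p, p \in P -> p.2 \subset Z \/ [disjoint p.2 & Z]) ->
  #|A| <= #|inside P Z|.
Proof.
move=> rA sA uA cl; set B := P :\: inside P Z.
have dAB : [disjoint B & A].
  rewrite -setI_eq0; apply/eqP/setP => a; rewrite !inE.
  apply/negP => /andP[/andP[_ aP] aA].
  by have := unusedP (uA a aA) aP; rewrite eqxx.
have rBA : rainbow (B :|: A).
  apply: rainbowU => // [|a b].
    exact: rainbowS (subsetDl _ _) rainbowP0.
  rewrite !inE => /andP[nin aP] bA; split; first exact: unusedP (uA b bA) aP.
  have [h|h] := cl a aP; first by rewrite aP h in nin.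
  exact: disjointWr (sA b bA) h.
have := maxP rBA; have /leqifP := leq_card_setU B A; rewrite dAB => /eqP ->.
have := cardsID (inside P Z) P; rewrite -/B.
have -> : P :&: inside P Z = inside P Z.
  by apply/setIidPr/subsetP => p; rewrite inE => /andP[].
by lia.
Qed.

Hypothesis F_once : forall p x y, p \in P -> x \in F -> y \in F ->
  x \in p.2 -> y \in p.2 -> x = y.

(** Release [u] away from [star P v], then [v] away from the first exchange and its colours; adding
    [uv] gains one edge, against maximality. By [F_once], [u] and its edge of [P] miss [star P v].
    The budget covers [3 + 2 * k] vertices in the first release and [(2 * k + 1) + 2 * k] in the
    second. *)
Lemma no_inner_edge c u v : 4 * k + 3 <= N ->
  c \in unused P -> u \in F -> v \in F -> [set u; v] \notin M c.
Proof.
move=> hN cU uF vF; apply/negP => uvM.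
have nuv : u != v.
  by have := matching_card (matchingM c) uvM; rewrite cards2; case: eqVneq.
have [|p pP up||| Z1 [A1 [[uZ rA sA uA cl kA] [ZB kZ kA' AC]]]] :=
    robustF uF (BV := star P v) (BC := [set c]).
- rewrite !inE (negPf nuv) /=; apply/bigcupP => -[p /andP[pP vp] up].
  by rewrite (F_once pP uF vF up vp) eqxx in nuv.
- rewrite -setI_eq0; apply/eqP/setP => z; rewrite !inE.
  apply/negP => /andP[zp /orP[/eqP zv|]].
    by rewrite zv in zp; rewrite (F_once pP uF vF up zp) eqxx in nuv.
  case/bigcupP => q /andP[qP vq] zq.
  move: up; rewrite (rainbow_eq rainbowP0 pP qP zp zq) => uq.
  by rewrite (F_once qP uF vF uq vq) eqxx in nuv.
- by have := card_star v rainbowP0; lia.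
- by rewrite cards1; lia.
have vZ1 : v \notin Z1 by rewrite (disjointFl ZB) // !inE eqxx.
have [|p pP vp||| Z2 [A2 [[vZ rA2 sA2 uA2 cl2 kA2] [ZB2 kZ2 kA2' AC2]]]] :=
    robustF vF (BV := Z1) (BC := c |: [set a.1 | a in A1]).
- exact: vZ1.
- by rewrite disjoint_sym; apply: disjointWr (mem_star pP vp) ZB.
- by move: hN kZ; clear; lia.
- apply: leq_trans (leq_add (leq_card_setU _ _) (leqnn _)) _; rewrite cards1.
  have hA1 := leq_trans (leq_imset_card fst (mem A1)) kA'.
  apply: leq_trans (leq_add (leq_add (leqnn 1) hA1) (leqnn k)) _.
  by move: hN; clear; lia.
have uZ2 : u \notin Z2 by rewrite (disjointFl ZB2).
have cA1 a : a \in A1 -> a.1 != c by move/AC; rewrite inE.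
have cA2' a : a \in A2 -> a.1 != c.
  by move/AC2; rewrite !inE negb_or => /andP[].
have cA12 a b : a \in A1 -> b \in A2 -> a.1 != b.1.
  move=> aA bA; have := AC2 b bA; rewrite !inE negb_or => /andP[_].
  by apply: contraNneq => <-; apply: imset_f.
have sA1' a : a \in A1 -> a.2 \subset Z1.
  by move/sA => h; apply: subset_trans h (subsetDl _ _).
have sA2' a : a \in A2 -> a.2 \subset Z2.
  by move/sA2 => h; apply: subset_trans h (subsetDl _ _).
set A := (c, [set u; v]) |: (A1 :|: A2).
have rA12 : rainbow (A1 :|: A2).
  apply: rainbowU => // a b aA bA; split; first exact: cA12.
  by rewrite disjoint_sym; apply: disjointW (sA2' _ bA) (sA1' _ aA) ZB2.
have rA' : rainbow A.
  apply: rainbowU (rainbow1 uvM) rA12 _ => a b /set1P -> /= /setUP[bA|bA].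
    rewrite eq_sym cA1 //; split=> //.
    rewrite disjointsUl !disjoints1; apply/andP; split; apply/negP.
      by move/(subsetP (sA _ bA)); rewrite !inE eqxx.
    by move/(subsetP (sA1' _ bA)); apply/negP.
  rewrite eq_sym cA2' //; split=> //.
  rewrite disjointsUl !disjoints1; apply/andP; split; apply/negP.
    by move/(subsetP (sA2' _ bA)); apply/negP.
  by move/(subsetP (sA2 _ bA)); rewrite !inE eqxx.
have cardA : #|A| = (#|A1| + #|A2|).+1.
  rewrite cardsU1; case: (boolP (_ \in _)) => [/setUP[/cA1|/cA2']|_].
  - by rewrite eqxx.
  - by rewrite eqxx.
  have /leqifP := leq_card_setU A1 A2.
  have -> : [disjoint A1 & A2]; last by move/eqP->.
  rewrite -setI_eq0; apply/eqP/setP => a; rewrite !inE.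
  by apply/negP => /andP[aA /(cA12 a a aA)]; rewrite eqxx.
have : #|A| <= #|inside P (Z1 :|: Z2)|.
  apply: max_inside => // [a|a|p pP].
  - case/setU1P=> [-> /=|/setUP[/sA1' h|/sA2' h]]; last 2 first.
    + exact: subset_trans h (subsetUl _ _).
    + exact: subset_trans h (subsetUr _ _).
    by rewrite subUset !sub1set !inE uZ vZ orbT.
  - by case/setU1P=> [-> //|/setUP[/uA|/uA2]].
  - have [h|h1] := cl p pP.
      by left; exact: subset_trans h (subsetUl _ _).
    have [h|h2] := cl2 p pP.
      by left; exact: subset_trans h (subsetUr _ _).
    right; rewrite disjoint_sym disjointsUl ![[disjoint _ & p.2]]disjoint_sym.
    by rewrite h1.
(* No edge of [P] is split between [Z1] and [Z2], as each contains it or misses it. *)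
have : #|inside P (Z1 :|: Z2)| <= #|inside P Z1 :|: inside P Z2|.
  apply: subset_leq_card; apply/subsetP => p; rewrite !inE => /andP[pP sp].
  rewrite pP /=; have [-> //|h1] := cl p pP.
  apply/orP; right; apply/subsetP => z zp.
  by have := subsetP sp z zp; rewrite inE (disjointFr h1).
have := leq_card_setU (inside P Z1) (inside P Z2) => -[+ _].
by move: kA kA2 cardA; clear; lia.
Qed.

End Extension.
End RainbowMatchings.

(** * Linear growth of the set of vertices that can be uncovered *)

Section Growth.
Variables (V : finType) (m : nat) (M : 'I_m -> {set {set V}}).
Hypothesis matchingM : forall i, matching (M i).
Local Notation cedge := ('I_m * {set V})%type.
Implicit Types (P Q : {set cedge}) (p q : cedge) (F : {set V}).

Definition hit P F : {set cedge} := [set p in P | ~~ [disjoint p.2 & F]].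

(** The invariant after [k] rounds. Progress is measured by [hit P F], whose size cannot exceed
    [#|P|]. *)
Record growing P N k F : Prop := Growing {
  grow_robust : forall v, v \in F -> robust M P N k v;
  grow_once : forall p x y, p \in P -> x \in F -> y \in F ->
    x \in p.2 -> y \in p.2 -> x = y;
  grow_uncovered : forall v, (forall p, p \in P -> v \notin p.2) -> v \in F }.

Variables (P : {set cedge}) (n g mu tau N : nat).
Hypothesis rainbowP0 : rainbow M P.
Hypothesis maxP : forall Q, rainbow M Q -> #|Q| <= #|P|.
Hypothesis card_M : forall i, n <= #|M i|.
Hypothesis gap : #|P| + g <= n.
Hypothesis mult : forall e, edge_mult M e <= mu.
Hypothesis unused_gt0 : 0 < #|unused P|.
Hypothesis tau_small : 4 * #|P| * tau <= #|unused P| * g.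
Hypothesis tau_large : N + N * (3 * mu) < tau.

Definition attached F c : {set V} :=
  [set x in ~: F | [exists v in F, [set x; v] \in M c]].

Definition swappable F c q :=
  [disjoint q.2 & F] && ~~ [disjoint q.2 & attached F c].

(** Each edge of [M c] counts at least 2 when its vertices outside [F] and its attached vertices are
    added up, since it never lies inside [F]. The total, at least [2 * n], is distributed over the
    edges of [P], which cover the complement of [F]: a swappable edge receives at most 4, any other
    at most 2. Hence at least [n - #|P|] edges are swappable. *)
Lemma swappable_card k F c : 4 * k + 3 <= N -> growing P N k F ->
  c \in unused P -> g <= #|[set q in P | swappable F c q]|.
Proof.
move=> hN [rF oF uF] cU; have sX : attached F c \subset ~: F.
  by apply/subsetP => x; rewrite inE => /andP[].
have covered x : x \in ~: F -> exists2 p, p \in P & x \in p.2.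
  rewrite inE => xF; have [p /andP[pP xp]|h] := pickP [pred p in P | x \in p.2].
    by exists p.
  move/negP: xF; case; apply: uF => p pP; apply/negP => xp.
  by have := h p; rewrite /= pP xp.
have low : 2 * n <= \sum_(e in M c) (#|e :&: ~: F| + #|e :&: attached F c|).
  apply: (@leq_trans (\sum_(e in M c) 2)).
    by rewrite sum_nat_const mulnC leq_mul2r card_M orbT.
  apply: leq_sum => e eM; have e2 := matching_card (matchingM c) eM.
  move/eqP/cards2P: (e2) => [x [y [nxy exy]]].
  have xye : [set x; y] \in M c by rewrite -exy.
  have yxe : [set y; x] \in M c by rewrite setUC.
  have inner := no_inner_edge matchingM rainbowP0 rF maxP oF hN cU.
  have cI z (W : {set V}) : z \in e -> z \in W -> 0 < #|e :&: W|.
    by move=> ze zW; apply/card_gt0P; exists z; rewrite inE ze.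
  have xe : x \in e by rewrite exy !inE eqxx.
  have ye : y \in e by rewrite exy !inE eqxx orbT.
  have [xF|xF] := boolP (x \in F); have [yF|yF] := boolP (y \in F).
  - by have := inner _ _ xF yF; rewrite xye.
  - have yX : y \in attached F c.
      by rewrite !inE yF /=; apply/exists_inP; exists x.
    by apply: (@leq_add 1 1); apply: (cI y) => //; rewrite inE.
  - have xX : x \in attached F c.
      by rewrite !inE xF /=; apply/exists_inP; exists y.
    by apply: (@leq_add 1 1); apply: (cI x) => //; rewrite inE.
  - rewrite (setIidPl _) ?e2 ?leq_addr //.
    by rewrite exy subUset !sub1set !inE xF yF.
have up : \sum_(e in M c) (#|e :&: ~: F| + #|e :&: attached F c|) <=
    \sum_(q in P) (2 + swappable F c q * 2).
  rewrite big_split /=.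
  apply: leq_trans (leq_add (sum_card_matching_le _ (matchingM c))
                            (sum_card_matching_le _ (matchingM c))) _.
  rewrite -(sum_card_rainbow rainbowP0 covered).
  rewrite -(sum_card_rainbow rainbowP0 (W := attached F c)); last first.
    by move=> x /(subsetP sX) /covered.
  rewrite -big_split; apply: leq_sum => q qP /=.
  have q2 := rainbow_card matchingM rainbowP0 qP; rewrite /swappable.
  have h1 : #|q.2 :&: ~: F| <= 2 by rewrite -q2 subset_leq_card ?subsetIl.
  have h2 : #|q.2 :&: attached F c| <= #|q.2 :&: ~: F|.
    by rewrite subset_leq_card ?setIS.
  have [dF|dF] := boolP [disjoint q.2 & F].
    have [dX|dX] := boolP [disjoint q.2 & attached F c]; last first.
      exact: leq_add h1 (leq_trans h2 h1).
    by rewrite (disjoint_setI0 dX) cards0 /= addn0.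
  (* An edge meeting [F] has at most one vertex outside it, which counts at most twice. *)
  have : #|q.2 :&: F| != 0 by rewrite cards_eq0 setI_eq0.
  have : #|q.2 :&: F| + #|q.2 :&: ~: F| = 2 by rewrite -setDE cardsID.
  move: h2; move: (#|q.2 :&: F|) (#|q.2 :&: ~: F|) (#|q.2 :&: attached F c|).
  by clear; lia.
have : \sum_(q in P) (2 + swappable F c q * 2) =
    2 * #|P| + 2 * #|[set q in P | swappable F c q]|.
  rewrite big_split sum_nat_const -big_distrl /= -sum1dep_card.
  rewrite [in RHS]big_mkcondr /= (mulnC _ 2) [X in _ + X = _]mulnC.
  by congr (_ + 2 * _); apply: eq_bigr => q _; case: (swappable F c q).
by move: low up gap; clear; lia.
Qed.

(** The factor 2 leaves [tau] colours at one of the two ends of the edge. *)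
Definition rich F : {set cedge} :=
  [set q in P | [disjoint q.2 & F] &&
     (2 * tau <= #|[set c in unused P | swappable F c q]|)].

Lemma card_rich k F : 4 * k + 3 <= N -> growing P N k F -> g <= 2 * #|rich F|.
Proof.
move=> hN gF.
have low : #|unused P| * g <=
    \sum_(c in unused P) #|[set q in P | swappable F c q]|.
  rewrite -sum_nat_const; apply: leq_sum => c; exact: swappable_card gF.
have up : \sum_(c in unused P) #|[set q in P | swappable F c q]| <=
    2 * tau * #|P| + #|unused P| * #|rich F|.
  rewrite sum_card_exchange.
  have -> : 2 * tau * #|P| + #|unused P| * #|rich F| =
     \sum_(q in P) (2 * tau + #|unused P| * (q \in rich F)).
    rewrite big_split sum_nat_const -big_distrr /= mulnC; congr (_ + _ * _).
    rewrite -sum1_card -big_mkcondr; apply: eq_bigl => q.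
    by rewrite !inE; case: (q \in P).
  apply: leq_sum => q qP; rewrite inE qP /=.
  have [dF|dF] := boolP [disjoint q.2 & F]; last first.
    by rewrite eq_card0 // => c; rewrite !inE /swappable (negPf dF) andbF.
  rewrite /=; case: (leqP (2 * tau) _) => h; last first.
    by rewrite /= muln0 addn0 ltnW.
  rewrite muln1; apply: leq_trans (leq_addl _ _).
  by apply: subset_leq_card; apply/subsetP => c; rewrite inE => /andP[].
rewrite -(leq_pmul2l unused_gt0).
move: low up tau_small; clear; nia.
Qed.

Lemma rich_robust k F q : growing P N k F -> q \in rich F ->
  exists2 y, y \in q.2 & robust M P N k.+1 y.
Proof.
move=> [rF _ _]; rewrite inE => /and3P[qP dF big].
have /eqP/cards2P [x [y [nxy exy]]] := rainbow_card matchingM rainbowP0 qP.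
pose D x := [set c in unused P | [exists v in F, [set x; v] \in M c]].
have : #|[set c in unused P | swappable F c q]| <= #|D x| + #|D y|.
  apply: leq_trans (leq_card_setU _ _); apply: subset_leq_card.
  apply/subsetP => c; rewrite !inE => /and3P[-> _ /=].
  rewrite -setI_eq0 => /set0Pn [z /setIP[]]; rewrite exy !inE.
  by case/orP => /eqP-> /andP[_ ->]; rewrite ?orbT.
have [hx _|hx hxy] := leqP tau #|D x|.
  exists y; first by rewrite exy !inE eqxx orbT.
  apply: (robust_step matchingM rainbowP0 rF mult qP exy dF).
  exact: leq_trans tau_large hx.
exists x; first by rewrite exy !inE eqxx.
apply: (robust_step (x := y) matchingM rainbowP0 rF mult qP _ dF).
  by rewrite exy setUC.
apply: leq_trans tau_large _.
by rewrite -/(D y); move: big hx hxy; clear; lia.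
Qed.

(** One robust end of each rich edge joins [F]. Rich edges miss [F], so all of them are newly
    hit. *)
Lemma growing_step k F : 4 * k + 3 <= N -> growing P N k F ->
  exists2 F', growing P N k.+1 F' & 2 * #|hit P F| + g <= 2 * #|hit P F'|.
Proof.
move=> hN gF.
(* A set is chosen instead of a vertex, so that [set0] can be the default for edges that are not
   rich. *)
have /fin_all_exists [s hs] : forall q, exists s : {set V}, q \in rich F ->
    exists y, [/\ s = [set y], y \in q.2 & robust M P N k.+1 y].
  move=> q; have [qR|_] := boolP (q \in rich F); last by exists set0.
  have [y yq ry] := rich_robust gF qR.
  by exists [set y] => _; exists y.
have richP q : q \in rich F -> q \in P /\ [disjoint q.2 & F].
  by rewrite inE => /and3P[].
have sE q x : q \in rich F -> x \in s q ->
    [/\ s q = [set x], x \in q.2 & robust M P N k.+1 x].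
  by move=> /hs [y [-> yq ry]] /set1P ->.
case: (gF) => rF oF uF.
exists (F :|: \bigcup_(q in rich F) s q).
  split=> [v|p x y pP|v hv]; last by rewrite inE uF.
    case/setUP=> [/rF/robustS //|/bigcupP [q qR vs]].
    by have [] := sE q v qR vs.
  have mixed z z' q : z \in F -> q \in rich F -> z' \in s q ->
      z \in p.2 -> z' \in p.2 -> False.
    move=> zF qR zs zp zp'; have [qP dF] := richP q qR.
    have [_ zq' _] := sE q z' qR zs.
    move: (disjointFl dF zF).
    by rewrite (rainbow_eq rainbowP0 qP pP zq' zp') zp.
  case/setUP=> [xF|/bigcupP [q qR xs]]; case/setUP=> [yF|/bigcupP [r rR ys]].
  - exact: oF.
  - by move=> xp yp; case: (mixed x y r).
  - by move=> xp yp; case: (mixed y x q).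
  move=> xp yp; have [qP _] := richP q qR; have [rP _] := richP r rR.
  have [esx xq _] := sE q x qR xs; have [_ yr _] := sE r y rR ys.
  move: ys; rewrite (rainbow_eq rainbowP0 rP pP yr yp).
  by rewrite -(rainbow_eq rainbowP0 qP pP xq xp) esx => /set1P.
have sub : hit P F :|: rich F \subset hit P (F :|: \bigcup_(q in rich F) s q).
  apply/subsetP => q /setUP[]; rewrite ?inE.
    case/andP=> -> /=; apply: contra; exact: disjointWr (subsetUl _ _).
  move=> qR; have qR' : q \in rich F by rewrite inE.
  case/andP: qR => -> _ /=; have [y [ey yq _]] := hs q qR'.
  rewrite -setI_eq0; apply/set0Pn; exists y; rewrite !inE yq.
  apply/orP; right; apply/bigcupP; exists q => //; by rewrite ey set11.
have dis : [disjoint hit P F & rich F].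
  rewrite -setI_eq0; apply/eqP/setP => q; rewrite !inE.
  by case: [disjoint q.2 & F]; rewrite ?andbF.
have /leqifP := leq_card_setU (hit P F) (rich F); rewrite dis => /eqP e.
have := subset_leq_card sub; rewrite e.
by have := card_rich hN gF; clear; lia.
Qed.

Lemma no_large_gap L : N = 4 * L + 3 -> L * g <= 2 * #|P|.
Proof.
move=> hN.
have iter k : k <= L -> exists2 F, growing P N k F & k * g <= 2 * #|hit P F|.
  elim: k => [_|k IH kL].
    (* The growth starts from the uncovered vertices. *)
    exists [set v | [forall p in P, v \notin p.2]] => //; split.
    - move=> v; rewrite inE => /forall_inP hv; exact: robust0.
    - move=> p x y pP; rewrite !inE => /forall_inP/(_ p pP) hx _ xp.
      by rewrite xp in hx.
    - by move=> v hv; rewrite inE; apply/forall_inP.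
  have [F gF hF] := IH (ltnW kL).
  have [|F' gF' hF'] := growing_step _ gF; first by rewrite hN; lia.
  by exists F' => //; move: hF hF'; clear; nia.
have [F _ hF] := iter L (leqnn L); apply: leq_trans hF _.
rewrite leq_mul2l; apply: subset_leq_card.
by apply/subsetP => p; rewrite inE => /andP[].
Qed.

End Growth.

(** * From almost full to full *)

Lemma rainbow_transversal (V : finType) (m : nat)
    (M : 'I_m -> {set {set V}}) Q :
  rainbow M Q -> #|Q| = m -> exists e, full_rainbow_matching M e.
Proof.
move=> rQ cQ; have U0 : unused Q = set0.
  apply/eqP; rewrite -cards_eq0 -(eqn_add2r #|Q|) (card_unused rQ) cQ.
  by rewrite add0n.
have /fin_all_exists [e he] : forall i, exists e, (i, e) \in Q.
  move=> i; have : i \notin unused Q by rewrite U0 inE.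
  by rewrite inE negbK => /imsetP [[j e] jQ /= ->]; exists e.
exists e; split=> [i|i j nij]; first exact: (rainbow_mem rQ (he i)).
by apply: (rainbow_disjoint rQ (he i) (he j)); apply: contraNneq nij => -[->].
Qed.

Lemma rainbow_sub (V : finType) (m : nat) (M M' : 'I_m -> {set {set V}}) Q :
  (forall i, M' i \subset M i) -> rainbow M' Q -> rainbow M Q.
Proof.
move=> sM /rainbowP[h1 h2]; apply/rainbowP; split=> // a /h1.
exact: (subsetP (sM _)).
Qed.

Lemma greedy_completion (V : finType) (m : nat) (M : 'I_m -> {set {set V}})
    (P : {set 'I_m * {set V}}) (S : {set V}) :
  (forall i, matching (M i)) -> rainbow M P ->
  (forall p, p \in P -> [disjoint p.2 & S]) ->
  (forall i, 2 * #|unused P| <= #|within (M i) S|) ->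
  exists2 Q, rainbow M Q & #|Q| = m.
Proof.
move=> mM rP dP hS.
have step k : k <= #|unused P| -> exists Q, [/\ rainbow M Q, P \subset Q,
    (forall q, q \in Q :\: P -> q.2 \subset S) & #|Q :\: P| = k].
  elim: k => [_|k IH hk].
    by exists P; rewrite setDv cards0; split=> // q; rewrite inE.
  have [Q [rQ PQ sQ cQ]] := IH (ltnW hk).
  have [c cU] : exists c, c \in unused Q.
    apply/card_gt0P; have := card_unused rQ; have := card_unused rP.
    have := cardsID P Q; rewrite (setIidPr PQ) cQ.
    by move: hk; clear; lia.
  set W := \bigcup_(q in Q :\: P) q.2.
  have cW : #|W| <= k * 2.
    rewrite -cQ; apply: card_bigcup_le => q /setDP[qQ _].
    by rewrite (rainbow_card mM rQ qQ).
  have [e] : exists e, e \in [set e in within (M c) S | [disjoint e & W]].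
    apply/card_gt0P; rewrite lt0n; apply/negP; rewrite cards_eq0 => /eqP e0.
    have mN : matching (within (M c) S).
      by apply: matchingS (mM c); apply/subsetP => e; rewrite inE => /andP[].
    have := sum_card_matching_le W mN.
    suff : #|within (M c) S| <= \sum_(e in within (M c) S) #|e :&: W|.
      by move: (hS c) cW hk; clear; lia.
    rewrite -sum1_card; apply: leq_sum => e eN.
    rewrite lt0n cards_eq0 setI_eq0; apply/negP => dW.
    by have := in_set0 e; rewrite -e0 inE eN dW.
  rewrite !inE => /andP[/andP[eM eS] eW].
  have ceQ : (c, e) \notin Q.
    by apply/negP => /(unusedP cU); rewrite eqxx.
  have ceP : (c, e) \notin P by apply: contra ceQ; exact: (subsetP PQ).
  exists ((c, e) |: Q); split.
  - apply: rainbowU (rainbow1 eM) rQ _ => a b /set1P -> bQ /=.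
    rewrite eq_sym (unusedP cU bQ); split=> //.
    have [bP|bP] := boolP (b \in P).
      by rewrite disjoint_sym; apply: disjointWr eS (dP b bP).
    apply: disjointWr eW; apply: bigcup_sup; by rewrite inE bP.
  - exact: subset_trans PQ (subsetUr _ _).
  - move=> q; rewrite !inE => /andP[qP /orP[/eqP-> //|qQ]].
    by apply: sQ; rewrite inE qP.
  - rewrite setDUl; have -> : [set (c, e)] :\: P = [set (c, e)].
      by apply/setDidPl; rewrite disjoints1.
    by rewrite cardsU1 cQ !inE (negPf ceQ) andbF.
have [Q [rQ PQ _ cQ]] := step _ (leqnn _); exists Q => //.
have := card_unused rP; have := cardsID P Q; rewrite (setIidPr PQ) cQ.
by clear; lia.
Qed.

(** The hypotheses give [2 * c * mu <= n], and [mu + 1 <= 2 * mu] unless [mu = 0]. *)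
Lemma square_root_small (c mu n : nat) :
  0 < c -> mu ^ 2 <= n -> 4 * c ^ 2 <= n -> c * mu.+1 <= n.
Proof.
move=> c0 hmu hn; have hm : (2 * (c * mu)) ^ 2 <= n ^ 2.
  have : 4 * c ^ 2 * mu ^ 2 <= n * n by exact: leq_mul.
  by rewrite !expnMn; lia.
rewrite leq_exp2r // in hm.
case: mu hmu hm => [|mu] _ hm; last by nia.
by rewrite muln1; apply: leq_trans hn; nia.
Qed.

(** Here [1 / K] plays the role of the deficiency. The reservoir costs each matching at most half of
    it, so a gap of at least [n / (2 * K)] remains between [P] and the matchings outside [S]. *)
Lemma rainbow_of_deficient_family (K : nat) : 0 < K ->
  exists n0, forall n, n0 <= n ->
  forall (V : finType) (m mu : nat) (M : 'I_m -> {set {set V}}),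
    K * m + n <= K * n -> (forall i, matching (M i)) ->
    (forall i, #|M i| = n) -> (forall e, edge_mult M e <= mu) -> mu ^ 2 <= n ->
    exists e, full_rainbow_matching M e.
Proof.
move=> K0; have J0 : 0 < 2 * K by rewrite muln_gt0.
have [q0 [n1 hres]] := exists_reservoir J0.
(* [q] is made positive, [N] is the budget for [4 * K] rounds of growth, and [c] ensures
   [N + 3 * N * mu < tau] through [c * (mu + 1) <= n]. *)
pose q := q0.+1; pose N := 4 * (4 * K) + 3.
pose c := 16 * q * K * (4 * N + 1).
exists (maxn n1 (4 * c ^ 2)) => n; rewrite geq_max => /andP[hn1 hn2].
move=> V m mu M hm mM cM hmu mun.
have c0 : 0 < c by rewrite !muln_gt0 K0 addn1.
have n0 : 0 < n by apply: leq_trans hn2; rewrite muln_gt0 expn_gt0 c0.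
have mn : m <= n by rewrite -(leq_pmul2l K0) (leq_trans (leq_addr _ _) hm).
have [S hS] := hres n hn1 V m M mn mM cM.
pose M' i := within (M i) (~: S).
have sM i : M' i \subset M i by apply/subsetP => e; rewrite inE => /andP[].
have mM' i : matching (M' i) by exact: matchingS (sM i) (mM i).
have [P rP maxP] :=
  @arg_maxnP _ set0 (rainbow M') (fun Q => #|Q|) (rainbow0 M').
have [small|large] := leqP (2 * #|unused P| * q) n.
  have [|p pP|i|Q rQ cQ] := @greedy_completion V m M P S mM.
  - exact: rainbow_sub sM rP.
  - have := rainbow_mem rP pP; rewrite inE disjoints_subset.
    by case/andP.
  - have [hi _] := hS i; rewrite -(leq_pmul2r (ltn0Sn q0)).
    apply: leq_trans small _; apply: leq_trans hi _.
    by rewrite mulnC leq_mul2l leqnSn orbT.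
  exact: rainbow_transversal rQ cQ.
pose g := n - n %/ (2 * K) - #|P|; pose tau := n %/ (16 * q * K).
have Pm : #|P| <= m by rewrite -[leqRHS](card_unused rP) leq_addl.
have hd : n %/ (2 * K) * (2 * K) <= n by exact: leq_divM.
have gap : #|P| + g <= n - n %/ (2 * K).
  rewrite /g subnKC //; move: hd hm Pm K0; clear; nia.
have gn : n <= 2 * K * g.
  rewrite /g; move: hd hm Pm K0; clear; nia.
have cM' i : n - n %/ (2 * K) <= #|M' i|.
  have [_ hi] := hS i; rewrite leq_subLR addnC -leq_subLR leq_divRL //.
  by rewrite mulnBl; move: hi; rewrite /M'; clear; nia.
have U0 : 0 < #|unused P|.
  by rewrite lt0n; apply: contraTneq large => ->; rewrite -leqNgt.
have multM' e : edge_mult M' e <= mu.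
  apply: leq_trans (hmu e); apply: subset_leq_card.
  by apply/subsetP => i; rewrite !inE => /andP[].
have qK : 0 < 16 * q * K by rewrite !muln_gt0 K0.
have htau : tau * (16 * q * K) <= n by exact: leq_divM.
have tau_small : 4 * #|P| * tau <= #|unused P| * g.
  have Pn : #|P| <= n := leq_trans Pm mn.
  have h1 : #|P| * (tau * (16 * q * K)) <= n * n by exact: leq_mul.
  have h2 : n * n <= (2 * #|unused P| * q) * (2 * K * g).
    by apply: leq_mul => //; exact: ltnW.
  have h3 := leq_trans h1 h2.
  have qK4 : 0 < 4 * (q * K) by rewrite !muln_gt0 K0.
  rewrite -(leq_pmul2l qK4).
  have -> : 4 * (q * K) * (4 * #|P| * tau) = #|P| * (tau * (16 * q * K)).
    by clear; ring.
  apply: leq_trans h3 _; apply: eq_leq; clear; ring.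
have tau_large : N + N * (3 * mu) < tau.
  rewrite leq_divRL //; apply: leq_trans (square_root_small c0 mun hn2).
  rewrite /c [leqLHS]mulnC -[leqRHS]mulnA leq_mul2l; apply/orP; right.
  by clear; move: N => N'; nia.
(* After [4 * K] rounds, [2 * n <= 4 * K * g <= 2 * #|P| <= 2 * m], whereas [m < n]. *)
have := no_large_gap mM' rP maxP cM' gap multM' U0 tau_small tau_large
  (erefl N).
by move: gn hm Pm n0 K0; clear; nia.
Qed.

(** * The statement with real parameters *)

Local Open Scope ring_scope.

Theorem theorem2p3 (R : realType) (eps0 : R) (eps0_gt0 : 0 < eps0) :
  exists n0 : nat, forall n : nat, (n0 <= n)%N ->
  forall (V : finType) (m : nat) (M : 'I_m -> {set {set V}}),
    m%:R <= (1 - eps0) * n%:R ->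
    (forall i, matching (M i)) ->
    (forall i, #|M i| = n) ->
    (forall e : {set V}, is_edge e ->
       (edge_mult M e)%:R <= Num.sqrt (n%:R : R) / ln (n%:R : R) ^+ 2) ->
    exists e : 'I_m -> {set V}, full_rainbow_matching M e.
Proof.
(* An integer with [1 / K <= eps0]. *)
pose K := (Num.bound eps0^-1).+1.
have epsK : 1 <= K%:R * eps0.
  rewrite -ler_pdivrMr // div1r; apply: ltW.
  have /archi_boundP h : 0 <= eps0^-1 by rewrite invr_ge0 ltW.
  by apply: lt_le_trans h _; rewrite ler_nat.
have [n1 hfam] := @rainbow_of_deficient_family K (ltn0Sn _).
(* From [n >= e] follows [ln n >= 1], so every multiplicity is at most the square root of [n]. *)
pose n2 := Num.bound (expR (1 : R)).
exists (maxn n1 n2) => n; rewrite geq_max => /andP[hn1 hn2].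
move=> V m M hm mM cM hmult.
pose mu := \max_(e : {set V}) edge_mult M e.
have e1n : expR 1 <= n%:R :> R.
  have /archi_boundP h : 0 <= expR (1 : R) by exact: expR_ge0.
  by apply: le_trans (ltW h) _; rewrite ler_nat.
have ln1 : 1 <= ln (n%:R : R).
  rewrite -[leLHS](expRK (1 : R)) ler_ln ?posrE ?expR_gt0 //.
  exact: lt_le_trans (expR_gt0 _) e1n.
have multn e : (edge_mult M e ^ 2 <= n)%N.
  have [he|he] := boolP (is_edge e); last first.
    (* A set that is not an edge belongs to no matching. *)
    have -> : edge_mult M e = 0%N; last by [].
    apply/eqP; rewrite cards_eq0 -subset0; apply/subsetP => i; rewrite !inE.
    by move/(matching_card (mM i))/eqP; rewrite -/(is_edge e) (negPf he).
  rewrite -(ler_nat R) natrX -[leRHS](@sqr_sqrtr R) //.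
  rewrite lerXn2r ?nnegrE ?sqrtr_ge0 //; apply: le_trans (hmult e he) _.
  rewrite ler_pdivrMr ?exprn_gt0 ?(lt_le_trans ltr01) //.
  by rewrite ler_peMr ?sqrtr_ge0 // exprn_ege1.
apply: (hfam n hn1 V m mu M) => // [|e|].
- rewrite -(ler_nat R) natrD !natrM.
  have n0 : 0 <= n%:R :> R by [].
  have K0 : 0 <= K%:R :> R by [].
  have := ler_wpM2l K0 hm; have := ler_wpM2r n0 epsK.
  by rewrite mulrBl mulrBr !mul1r mulrA; lra.
- exact: (@bigop.leq_bigmax _ (fun e => edge_mult M e) e).
- have [|e] := @bigop.eq_bigmax {set V} (fun e => edge_mult M e).
    by apply/card_gt0P; exists set0.
  by rewrite /mu => ->.
Qed.
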